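(* Let $\mathcal{Q}$ be a small quantaloid and let $r\in\mathcal{Q}_0$ be an object such that $\mathcal{Q}$ is $r$-stable. Let $(X,\alpha)$ be a separated and cocomplete $\mathcal{Q}$-category, and let $\varphi\colon(\mathcal{Q},\tau)\to(X,\alpha)$ be a cocontinuous functor. Then the commutative square $$\alpha(\underline{\phantom{x}},\varphi(r))\circ\varphi=\mathrm{true}_r\circ 1_{\mathcal{Q}_0},$$ with top arrow $\varphi\colon(\mathcal{Q},\tau)\to(X,\alpha)$, left vertical arrow $\alpha(\underline{\phantom{x}},\varphi(r))\colon(X,\alpha)\to(\mathbb{R}(\mathcal{R}^{r}),\varrho)$, $x\mapsto\alpha(x,\varphi(r))$, right vertical arrow the identity $1_{\mathcal{Q}_0}\colon(\mathcal{Q},\tau)\to(\mathcal{Q},\tau)$, and bottom arrow $\mathrm{true}_r\colon(\mathcal{Q},\tau)\to(\mathbb{R}(\mathcal{R}^{r}),\varrho)$, is a pullback square in the category $\mathtt{Cat}_{sc}(\mathcal{Q})$.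
   Context: **Quantaloids.** A small quantaloid $\mathcal{Q}$ is a small category (object set $\mathcal{Q}_0$, set of all morphisms $\mathrm{morph}(\mathcal{Q})$, identities $1_p$) in which each $\hom(p,q)$ is a complete lattice and composition $\circ\colon\hom(q,r)\times\hom(p,q)\to\hom(p,r)$ preserves arbitrary joins in each variable. For $u\in\hom(p,q)$, $v\in\hom(p,r)$ (same domain): $u\swarrow v=\bigvee\{h\in\hom(r,q)\mid h\circ v\le u\}$. For $u\in\hom(p,q)$, $v\in\hom(r,q)$ (same codomain): $v\searrow u=\bigvee\{h\in\hom(p,r)\mid v\circ h\le u\}$. For $r\in\mathcal{Q}_0$, $\mathcal{Q}$ is $r$-stable if $1_q\le(\bigvee\hom(r,q))\circ(\bigvee\hom(q,r))$ for all $q\in\mathcal{Q}_0$. **$\mathcal{Q}$-categories and functors.** A typed set is a set $X_0$ with a map $|\cdot|\colon X_0\to\mathcal{Q}_0$ (type map). A $\mathcal{Q}$-category $(X,\alpha)$ is a typed set $X$ with $\alpha\colon X_0\times X_0\to\mathrm{morph}(\mathcal{Q})$ such that $\alpha(x,y)\in\hom(|y|,|x|)$, $\alpha(x,y)\circ\alpha(y,z)\le\alpha(x,z)$ and $1_{|x|}\le\alpha(x,x)$. A functor $\varphi\colon(X,\alpha)\to(Y,\beta)$ is a type-preserving map $X_0\to Y_0$ with $\alpha(x_1,x_2)\le\beta(\varphi(x_1),\varphi(x_2))$. $(X,\alpha)$ is separated if $|x|=|y|$, $\alpha(x,x)=\alpha(x,y)$ and $\alpha(y,y)=\alpha(y,x)$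 imply $x=y$. **Presheaves, cocompleteness.** A contravariant $\mathcal{Q}$-presheaf on $(X,\alpha)$ is a pair $(p,g)$ with $p\in\mathcal{Q}_0$ (its type) and $g\colon X_0\to\mathrm{morph}(\mathcal{Q})$ such that $g(x)\in\hom(p,|x|)$ and $\alpha(x_1,x_2)\circ g(x_2)\le g(x_1)$. These form a $\mathcal{Q}$-category $(P(X,\alpha),\pi)$ with $\pi((p_1,g_1),(p_2,g_2))=\bigwedge_{x\in X_0}(g_1(x)\searrow g_2(x))$. The Yoneda embedding is $\eta_{(X,\alpha)}\colon(X,\alpha)\to(P(X,\alpha),\pi)$, $x\mapsto(|x|,\alpha(\underline{\phantom{x}},x))$. $(X,\alpha)$ is cocomplete if $\eta_{(X,\alpha)}$ has a left adjoint functor $\sup_X\colon(P(X,\alpha),\pi)\to(X,\alpha)$, i.e. $\alpha(\sup_X(p,g),x)=\pi((p,g),\eta_{(X,\alpha)}(x))$ for all $x,(p,g)$. For a functor $\varphi\colon(X,\alpha)\to(Y,\beta)$, the functor $\mathbb{P}(\varphi)\colon(P(X,\alpha),\pi)\to(P(Y,\beta),\pi)$ sends $(p,g)$ to the presheaf of type $p$ given by $y\mapsto\bigvee_{x\in X_0}\beta(y,\varphi(x))\circ g(x)$. A functor $\varphi$ between separated cocomplete $\mathcal{Q}$-categories is cocontinuous if $\varphi\circ\sup_X=\sup_Y\circ\,\mathbb{P}(\varphi)$. $\mathtt{Cat}_{sc}(\mathcal{Q})$ is the category of separated and cocomplete $\mathcal{Q}$-categories with cocontinuous functors. **Particular objects.**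 $(\mathcal{Q},\tau)$ is the $\mathcal{Q}$-category with underlying set $\mathcal{Q}_0$, type map the identity, and $\tau(p,q)=\bigvee\hom(q,p)$; it is the terminal object of $\mathtt{Cat}_{sc}(\mathcal{Q})$. A morphism $u$ with domain $r$ is right-sided if $u\circ\tau(r,r)\le u$. $(\mathbb{R}(\mathcal{R}^{r}),\varrho)$ is the separated cocomplete $\mathcal{Q}$-category whose underlying set $\mathbb{R}(\mathcal{R}_0^{r})$ consists of all right-sided morphisms with domain $r$, with type map $|u|=\mathrm{codom}(u)$ and $\varrho(u,v)=u\swarrow v$; here $\sup(p,g)=\bigwedge_{u}(g(u)\searrow u)$, the meet over all $u\in\mathbb{R}(\mathcal{R}_0^{r})$. The cocontinuous functor $\mathrm{true}_r\colon(\mathcal{Q},\tau)\to(\mathbb{R}(\mathcal{R}^{r}),\varrho)$ is $q\mapsto\tau(q,r)$. *)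

(* Defs.v *)
From mathcomp Require Import all_boot all_order.
From mathcomp Require Import boolp classical_sets.

Set Implicit Arguments.
Unset Strict Implicit.
Unset Printing Implicit Defensive.

Import Order.TTheory.
Local Obligation Tactic := idtac.
Local Open Scope order_scope.
Local Open Scope classical_set_scope.

Record quantaloid := Quantaloid {
  qdisp : Order.disp_t;
  qob :> Type;
  qhom : qob -> qob -> porderType qdisp;
  qid : forall p, qhom p p;
  qcomp : forall p q r, qhom q r -> qhom p q -> qhom p r;
  qjoin : forall p q, set (qhom p q) -> qhom p q;
  qcompA : forall p q r s (h : qhom r s) (g : qhom q r) (f : qhom p q),
    qcomp h (qcomp g f) = qcomp (qcomp h g) f;
  qcomp1f : forall p q (f : qhom p q), qcomp (qid q) f = f;
  qcompf1 : forall p q (f : qhom p q), qcomp f (qid p) = f;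
  qjoinP : forall p q (A : set (qhom p q)), supremums A (qjoin A);
  qcomp_joinl : forall p q r (A : set (qhom q r)) (f : qhom p q),
    qcomp (qjoin A) f = qjoin [set qcomp g f | g in A];
  qcomp_joinr : forall p q r (g : qhom q r) (A : set (qhom p q)),
    qcomp g (qjoin A) = qjoin [set qcomp g f | f in A] }.

Arguments qhom {q} p q0 : rename.
Arguments qid {q} p : rename.
Arguments qcomp {q p q0 r} : rename.
Arguments qjoin {q p q0} : rename.

Notation "g \oq f" := (qcomp g f) (at level 40, left associativity).

Section Quantaloid.
Variable Q : quantaloid.
Implicit Types p q r : Q.

Definition qmeet p q (A : set (qhom p q)) : qhom p q := qjoin (lbound A).

Definition qtop p q : qhom p q := qjoin [set: qhom p q].

Definition swarrow p q r (u : qhom p q) (v : qhom p r) : qhom r q :=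
  qjoin [set h | h \oq v <= u].

Definition searrow p q r (v : qhom r q) (u : qhom p q) : qhom p r :=
  qjoin [set h | v \oq h <= u].

Definition stable r := forall q, qid q <= qtop r q \oq qtop q r.

(* Transport along equalities of objects: [|phi x| = |x|] is only a
   propositional equality for a type-preserving map [phi]. *)
Definition hcast p p' q q' (ep : p = p') (eq : q = q') (f : qhom p q) :
    qhom p' q' :=
  let: erefl := ep in let: erefl := eq in f.

Lemma qjoin_ub p q (A : set (qhom p q)) f : A f -> f <= qjoin A.
Proof. by move=> Af; have [+ _] := qjoinP A; exact. Qed.

Lemma qjoin_le p q (A : set (qhom p q)) g :
  (forall f, A f -> f <= g) -> qjoin A <= g.
Proof. by move=> Ag; have [_] := qjoinP A; exact. Qed.

Lemma qmeet_lb p q (A : set (qhom p q)) f : A f -> qmeet A <= f.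
Proof. by move=> Af; apply: qjoin_le => g; exact. Qed.

Lemma qmeet_ge p q (A : set (qhom p q)) g :
  (forall f, A f -> g <= f) -> g <= qmeet A.
Proof. by move=> gA; apply: qjoin_ub. Qed.

Lemma qtop_ge p q (f : qhom p q) : f <= qtop p q.
Proof. exact: qjoin_ub. Qed.

Lemma qcomp_lel p q r (g g' : qhom q r) (f : qhom p q) :
  g <= g' -> g \oq f <= g' \oq f.
Proof.
move=> gg'; have -> : g' = qjoin [set g; g'].
  apply: le_anti; rewrite qjoin_ub /=; last by right.
  by apply: qjoin_le => ? [] ->.
by rewrite qcomp_joinl; apply: qjoin_ub; exists g => //; left.
Qed.

Lemma qcomp_ler p q r (g : qhom q r) (f f' : qhom p q) :
  f <= f' -> g \oq f <= g \oq f'.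
Proof.
move=> ff'; have -> : f' = qjoin [set f; f'].
  apply: le_anti; rewrite qjoin_ub /=; last by right.
  by apply: qjoin_le => ? [] ->.
by rewrite qcomp_joinr; apply: qjoin_ub; exists f => //; left.
Qed.

Lemma qcomp_le p q r (g g' : qhom q r) (f f' : qhom p q) :
  g <= g' -> f <= f' -> g \oq f <= g' \oq f'.
Proof. by move=> gg' ff'; apply: le_trans (qcomp_lel _ gg') (qcomp_ler _ ff'). Qed.

Lemma le_swarrow p q r (u : qhom p q) (v : qhom p r) (h : qhom r q) :
  (h <= swarrow u v) = (h \oq v <= u).
Proof.
apply/idP/idP => [hle|]; last exact: qjoin_ub.
apply: le_trans (qcomp_lel _ hle) _; rewrite qcomp_joinl.
by apply: qjoin_le => _ [g gvu <-].
Qed.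

Lemma le_searrow p q r (v : qhom r q) (u : qhom p q) (h : qhom p r) :
  (h <= searrow v u) = (v \oq h <= u).
Proof.
apply/idP/idP => [hle|]; last exact: qjoin_ub.
apply: le_trans (qcomp_ler _ hle) _; rewrite qcomp_joinr.
by apply: qjoin_le => _ [g gvu <-].
Qed.

Lemma hcast_id p q (ep : p = p) (eq : q = q) (f : qhom p q) : hcast ep eq f = f.
Proof. by rewrite (Prop_irrelevance ep erefl) (Prop_irrelevance eq erefl). Qed.

Lemma hcast_hcast p p' p'' q q' q'' (ep : p = p') (ep' : p' = p'')
    (eq : q = q') (eq' : q' = q'') (f : qhom p q) :
  hcast ep' eq' (hcast ep eq f) = hcast (etrans ep ep') (etrans eq eq') f.
Proof. by case: _ / ep'; case: _ / eq'; case: _ / ep; case: _ / eq. Qed.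

Lemma hcast_le p p' q q' (ep : p = p') (eq : q = q') (f g : qhom p q) :
  (hcast ep eq f <= hcast ep eq g) = (f <= g).
Proof. by case: _ / ep; case: _ / eq. Qed.

Lemma hcast_comp p p' q q' r r' (ep : p = p') (eq : q = q') (er : r = r')
    (g : qhom q r) (f : qhom p q) :
  hcast eq er g \oq hcast ep eq f = hcast ep er (g \oq f).
Proof. by case: _ / ep; case: _ / eq; case: _ / er. Qed.

Lemma hcast_compl p q r r' (er : r = r') (g : qhom q r) (f : qhom p q) :
  hcast erefl er g \oq f = hcast erefl er (g \oq f).
Proof. by case: _ / er. Qed.

Lemma hcast_compr p p' q r (ep : p = p') (g : qhom q r) (f : qhom p q) :
  g \oq hcast ep erefl f = hcast ep erefl (g \oq f).
Proof. by case: _ / ep. Qed.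

Lemma hcast_swap p q q' r (eq : q = q') (g : qhom q r) (f : qhom p q') :
  hcast eq erefl g \oq f = g \oq hcast erefl (esym eq) f.
Proof. by case: _ / eq f. Qed.

End Quantaloid.

Record qcat (Q : quantaloid) := QCat {
  qcat_ob :> Type;
  ty : qcat_ob -> Q;
  ht : forall x y : qcat_ob, qhom (ty y) (ty x);
  ht_comp : forall x y z, ht x y \oq ht y z <= ht x z;
  ht_id : forall x, qid (ty x) <= ht x x }.

Arguments ty {Q q} x : rename.
Arguments ht {Q q} x y : rename.

Section QCategories.
Variable Q : quantaloid.
Implicit Types X Y Z : qcat Q.

Record functor X Y := Functor {
  fn :> X -> Y;
  fn_ty : forall x, ty (fn x) = ty x;
  fn_ht : forall x1 x2,
    ht x1 x2 <= hcast (fn_ty x2) (fn_ty x1) (ht (fn x1) (fn x2)) }.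

Lemma functor_eq X Y (phi psi : functor X Y) : phi =1 psi -> phi = psi.
Proof.
case: phi psi => f fT fH [g gT gH] /= /funext fg.
by subst g; rewrite (Prop_irrelevance gT fT) in gH *; congr Functor.
Qed.

Definition functor_id X : functor X X :=
  @Functor X X id (fun=> erefl) (fun=> fun=> lexx _).

Program Definition functor_comp X Y Z (psi : functor Y Z) (phi : functor X Y) :
    functor X Z :=
  @Functor X Z (psi \o phi) (fun x => etrans (fn_ty psi (phi x)) (fn_ty phi x)) _.
Next Obligation.
move=> X Y Z psi phi x1 x2 /=.
rewrite -hcast_hcast; apply: le_trans (fn_ht phi x1 x2) _.
by rewrite hcast_le fn_ht.
Qed.

Definition separated X := forall (x y : X) (e : ty x = ty y),
  ht x x = hcast (esym e) erefl (ht x y) ->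
  ht y y = hcast e erefl (ht y x) -> x = y.

Record presheaf X := Presheaf {
  psh_ty : Q;
  psh_fn :> forall x : X, qhom psh_ty (ty x);
  psh_ht : forall x1 x2, ht x1 x2 \oq psh_fn x2 <= psh_fn x1 }.

Lemma presheaf_eq X p (g1 g2 : forall x : X, qhom p (ty x)) h1 h2 :
  (forall x, g1 x = g2 x) -> @Presheaf X p g1 h1 = @Presheaf X p g2 h2.
Proof.
move=> e; have {}e := functional_extensionality_dep e; subst g2.
by rewrite (Prop_irrelevance h1 h2).
Qed.

Definition psh_ht_fn X (g1 g2 : presheaf X) : qhom (psh_ty g2) (psh_ty g1) :=
  qmeet (range (fun x => searrow (g1 x) (g2 x))).

Program Definition psh X : qcat Q :=
  @QCat Q (presheaf X) (@psh_ty X) (@psh_ht_fn X) _ _.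
Next Obligation.
move=> X g1 g2 g3; apply: qmeet_ge => _ [x _ <-].
rewrite le_searrow qcompA.
have h12 : g1 x \oq psh_ht_fn g1 g2 <= g2 x.
  by rewrite -le_searrow; apply: qmeet_lb; exists x.
apply: le_trans (qcomp_lel _ h12) _.
by rewrite -le_searrow; apply: qmeet_lb; exists x.
Qed.
Next Obligation.
by move=> X g; apply: qmeet_ge => _ [x _ <-]; rewrite le_searrow qcompf1.
Qed.

Definition yoneda_psh X (x : X) : presheaf X :=
  @Presheaf X (ty x) (fun y => ht y x) (fun y1 y2 => ht_comp y1 y2 x).

Program Definition yoneda X : functor X (psh X) :=
  @Functor X (psh X) (@yoneda_psh X) (fun=> erefl) _.
Next Obligation.
move=> X x1 x2; apply: qmeet_ge => _ [y _ <-].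
by rewrite le_searrow; apply: ht_comp.
Qed.

Definition left_adjoint_yoneda X (s : functor (psh X) X) :=
  forall (g : psh X) (x : X),
    hcast erefl (fn_ty s g) (ht (s g) x) = ht g (yoneda X x).

Definition cocomplete X := exists s, @left_adjoint_yoneda X s.

Program Definition psh_map X Y (phi : functor X Y) (g : psh X) : psh Y :=
  @Presheaf Y (psh_ty g) (fun y => qjoin
    (range (fun x => hcast (fn_ty phi x) erefl (ht y (phi x)) \oq g x))) _.
Next Obligation.
move=> X Y phi g y1 y2; rewrite qcomp_joinr; apply: qjoin_le => _ [_ [x _ <-] <-].
rewrite qcompA hcast_compr; apply: le_trans (qjoin_ub _); last by exists x.
by apply: qcomp_lel; rewrite hcast_le ht_comp.
Qed.

Record sccat := SCCat {
  sccat_cat :> qcat Q;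
  sccat_sep : separated sccat_cat;
  sccat_cocomp : cocomplete sccat_cat }.

(* The left adjoint of the Yoneda embedding of a separated category is unique,
   so the choice below is irrelevant: see [sup_eq]. *)
Definition sup (X : sccat) : functor (psh X) X := projT1 (cid (sccat_cocomp X)).

Lemma supP (X : sccat) : left_adjoint_yoneda (sup X).
Proof. exact: projT2 (cid (sccat_cocomp X)). Qed.

Definition cocontinuous (X Y : sccat) (phi : functor X Y) :=
  forall g : psh X, phi (sup X g) = sup Y (psh_map phi g).

Record cocont (X Y : sccat) := Cocont {
  cocont_fun :> functor X Y;
  cocontP : cocontinuous cocont_fun }.

Lemma cocont_eq (X Y : sccat) (phi psi : cocont X Y) : phi =1 psi -> phi = psi.
Proof.
case: phi psi => f fC [g gC] /= /functor_eq fg; subst g.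
by rewrite (Prop_irrelevance fC gC).
Qed.

Lemma separated_eq X (x y : X) (e : ty x = ty y) : separated X ->
  qid (ty x) <= hcast (esym e) erefl (ht x y) ->
  qid (ty y) <= hcast e erefl (ht y x) -> x = y.
Proof.
have aux (p q : Q) (e' : p = q) (xx : qhom p p) (xy : qhom q p) (yx : qhom p q)
    (yy : qhom q q) :
    xy \oq yx <= xx -> yx \oq xy <= yy -> xx \oq xy <= xy -> yy \oq yx <= yx ->
    qid p <= hcast (esym e') erefl xy -> qid q <= hcast e' erefl yx ->
    xx = hcast (esym e') erefl xy /\ yy = hcast e' erefl yx.
  case: _ / e' xy yx yy => xy yx yy /= h1 h2 h3 h4 ixy iyx.
  split; apply: le_anti; apply/andP; split.
  - by rewrite -[xx]qcompf1; apply: le_trans (qcomp_ler _ ixy) h3.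
  - by rewrite -[xy]qcompf1; apply: le_trans (qcomp_ler _ iyx) h1.
  - by rewrite -[yy]qcompf1; apply: le_trans (qcomp_ler _ iyx) h4.
  - by rewrite -[yx]qcompf1; apply: le_trans (qcomp_ler _ ixy) h2.
move=> sX xy yx.
have [h1 h2] := aux _ _ e _ _ _ _ (ht_comp x y x) (ht_comp y x y)
  (ht_comp x x y) (ht_comp y y x) xy yx.
exact: sX h1 h2.
Qed.

Lemma adjoint_functor X (s : psh X -> X) (e : forall g, ty (s g) = psh_ty g) :
  (forall g x, hcast erefl (e g) (ht (s g) x) = psh_ht_fn g (yoneda_psh x)) ->
  forall g1 g2 : psh X, ht g1 g2 <= hcast (e g2) (e g1) (ht (s g1) (s g2)).
Proof.
move=> adj g1 g2.
have h := adj g1 (s g2).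
have -> : hcast (e g2) (e g1) (ht (s g1) (s g2)) =
    hcast (e g2) erefl (psh_ht_fn g1 (yoneda_psh (s g2))).
  rewrite -h hcast_hcast; congr (hcast _ _ _); exact: Prop_irrelevance.
have u : qid (psh_ty g2) <= hcast (e g2) erefl (psh_ht_fn g2 (yoneda_psh (s g2))).
  rewrite -adj hcast_hcast.
  have := ht_id (s g2); move: (ht (s g2) (s g2)) (e g2).
  by move: (psh_ty g2) => p f ep; case: _ / ep.
have := qcomp_ler (psh_ht_fn g1 g2) u; rewrite qcompf1 => /le_trans; apply.
by rewrite hcast_compr hcast_le; exact: (@ht_comp Q (psh X) g1 g2 (yoneda_psh (s g2))).
Qed.

Definition adjoint_of X (s : psh X -> X) (e : forall g, ty (s g) = psh_ty g)
    (adj : forall g x,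
      hcast erefl (e g) (ht (s g) x) = psh_ht_fn g (yoneda_psh x)) :
  functor (psh X) X := Functor (adjoint_functor adj).

Lemma sup_eq (X : sccat) (g : psh X) (x : X) (e : ty x = psh_ty g) :
  (forall y, hcast erefl e (ht x y) = psh_ht_fn g (yoneda_psh y)) ->
  sup X g = x.
Proof.
have aux (p q c : Q) (ep : p = c) (eq : q = c) (E : p = q)
    (f : qhom p p) (h : qhom p q) :
    hcast erefl ep f = hcast erefl eq h -> qid p <= f ->
    qid q <= hcast E erefl h.
  case: _ / E h eq => h eq /=.
  case: _ / ep eq => eq; rewrite (Prop_irrelevance eq erefl) => -> h1; exact: h1.
move=> adj; have adj' := @supP X g.
pose E := fn_ty (sup X) g; rewrite -/E in adj'.
apply: (separated_eq (e := etrans E (esym e))) (@sccat_sep X) _ _.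
- by apply: (aux _ _ _ e E) (ht_id x); rewrite adj [RHS]adj'.
- by apply: (aux _ _ _ E e) (ht_id (sup X g)); rewrite adj [LHS]adj'.
Qed.

Lemma cocontinuous_id (X : sccat) : cocontinuous (functor_id X : functor X X).
Proof.
move=> g /=; congr (sup X _); case: g => p g gP; apply: presheaf_eq => x.
apply: le_anti; apply/andP; split.
  apply: le_trans (qjoin_ub _); last by exists x.
  by rewrite /= -{1}[g x]qcomp1f; apply: qcomp_lel; apply: ht_id.
by apply: qjoin_le => _ [y _ <-]; apply: gP.
Qed.

Lemma psh_map_comp X Y Z (psi : functor Y Z) (phi : functor X Y) (g : psh X) :
  psh_map (functor_comp psi phi) g = psh_map psi (psh_map phi g).
Proof.
apply: presheaf_eq => z; apply: le_anti; apply/andP; split.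
- apply: qjoin_le => _ [x _ <-] /=.
  apply: le_trans (qjoin_ub _); last by exists (phi x).
  rewrite qcomp_joinr; apply: le_trans (qjoin_ub _); last first.
    by exists (hcast (fn_ty phi x) erefl (ht (phi x) (phi x)) \oq g x) => //; exists x.
  rewrite qcompA hcast_compr; apply: qcomp_lel.
  rewrite -(hcast_hcast _ _ erefl erefl) hcast_le -{1}[hcast _ _ _]qcompf1.
  by apply: qcomp_ler; apply: ht_id.
- apply: qjoin_le => _ [y _ <-] /=; rewrite qcomp_joinr.
  apply: qjoin_le => _ [_ [x _ <-] <-] /=.
  apply: le_trans (qjoin_ub _); last by exists x.
  rewrite qcompA hcast_compr; apply: qcomp_lel.
  rewrite -(hcast_hcast _ _ erefl erefl) hcast_le /=.
  apply: le_trans (qcomp_ler _ (fn_ht psi y (phi x))) _.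
  set a := fn_ty psi y; set b := fn_ty psi (phi x).
  by rewrite hcast_comp hcast_le; apply: ht_comp.
Qed.

Lemma cocontinuous_comp (X Y Z : sccat) (psi : functor Y Z) (phi : functor X Y) :
  cocontinuous psi -> cocontinuous phi -> cocontinuous (functor_comp psi phi).
Proof. by move=> psiC phiC g /=; rewrite phiC psiC psh_map_comp. Qed.

Definition cocont_id (X : sccat) : cocont X X := Cocont (@cocontinuous_id X).

Definition cocont_comp (X Y Z : sccat) (psi : cocont Y Z) (phi : cocont X Y) :
    cocont X Z :=
  Cocont (cocontinuous_comp (@cocontP _ _ psi) (@cocontP _ _ phi)).

End QCategories.

Record category := Category {
  cat_ob :> Type;
  cat_hom : cat_ob -> cat_ob -> Type;
  cat_id : forall A, cat_hom A A;
  cat_comp : forall A B C, cat_hom B C -> cat_hom A B -> cat_hom A C;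
  cat_compA : forall A B C D (h : cat_hom C D) (g : cat_hom B C)
      (f : cat_hom A B),
    cat_comp h (cat_comp g f) = cat_comp (cat_comp h g) f;
  cat_comp1f : forall A B (f : cat_hom A B), cat_comp (cat_id B) f = f;
  cat_compf1 : forall A B (f : cat_hom A B), cat_comp f (cat_id A) = f }.

Arguments cat_hom {c} A B : rename.
Arguments cat_id {c} A : rename.
Arguments cat_comp {c A B C} g f : rename.

Definition is_pullback (C : category) (A B A' B' : C)
    (top : cat_hom A B) (left : cat_hom B B')
    (right : cat_hom A A') (bottom : cat_hom A' B') :=
  cat_comp left top = cat_comp bottom right /\
  forall (Z : C) (f : cat_hom Z B) (g : cat_hom Z A'),
    cat_comp left f = cat_comp bottom g ->
    exists! h : cat_hom Z A, cat_comp top h = f /\ cat_comp right h = g.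

Program Definition Cat_sc (Q : quantaloid) : category :=
  @Category (sccat Q) (@cocont Q) (@cocont_id Q) (@cocont_comp Q) _ _ _.
Next Obligation. by move=> *; apply: cocont_eq. Qed.
Next Obligation. by move=> *; apply: cocont_eq. Qed.
Next Obligation. by move=> *; apply: cocont_eq. Qed.

Section Objects.
Variables (Q : quantaloid) (r : Q).

Definition tau (p q : Q) : qhom q p := qtop q p.

Program Definition tau_cat : qcat Q := @QCat Q Q id tau _ _.
Next Obligation. by move=> *; apply: qtop_ge. Qed.
Next Obligation. by move=> *; apply: qtop_ge. Qed.

Lemma tau_separated : separated tau_cat.
Proof. by move=> p q /=. Qed.

Lemma tau_adjoint (g : psh tau_cat) (q : tau_cat) :
  hcast erefl (erefl (psh_ty g)) (@ht Q tau_cat (psh_ty g) q) =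
  psh_ht_fn g (yoneda_psh q).
Proof.
apply: le_anti; rewrite qtop_ge andbT; apply: qmeet_ge => _ [p _ <-].
by rewrite le_searrow; apply: qtop_ge.
Qed.

Lemma tau_cocomplete : cocomplete tau_cat.
Proof. by exists (adjoint_of tau_adjoint); exact: tau_adjoint. Qed.

Definition tau_sc : sccat Q := SCCat tau_separated tau_cocomplete.

Definition right_sided q (u : qhom r q) := u \oq tau r r <= u.

Record rs_ob := RSOb {
  rs_ty : Q;
  rs_mor : qhom r rs_ty;
  rsP : right_sided rs_mor }.

Definition rho (u v : rs_ob) : qhom (rs_ty v) (rs_ty u) :=
  swarrow (rs_mor u) (rs_mor v).

Program Definition rs_cat : qcat Q := @QCat Q rs_ob rs_ty rho _ _.
Next Obligation.
move=> u v w; rewrite le_swarrow -qcompA.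
have h : rho v w \oq rs_mor w <= rs_mor v by rewrite -le_swarrow.
by apply: le_trans (qcomp_ler _ h) _; rewrite -le_swarrow.
Qed.
Next Obligation. by move=> u; rewrite le_swarrow qcomp1f. Qed.

Lemma rs_separated : separated rs_cat.
Proof.
move=> [p u uP] [q v vP] /= e; move: u v uP vP.
case: _ / e => u v uP vP /= h1 h2.
suff e : u = v by subst v; rewrite (Prop_irrelevance uP vP).
apply: le_anti; apply/andP; split.
- have := ht_id (RSOb vP : rs_cat); rewrite [ht _ _]h2 le_swarrow.
  by rewrite qcomp1f.
- have := ht_id (RSOb uP : rs_cat); rewrite [ht _ _]h1 le_swarrow.
  by rewrite qcomp1f.
Qed.

Definition rs_sup_mor (g : psh rs_cat) : qhom r (psh_ty g) :=
  qmeet (range (fun u : rs_cat => searrow (g u) (rs_mor u))).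

Lemma rs_sup_right_sided (g : psh rs_cat) : right_sided (rs_sup_mor g).
Proof.
apply: qmeet_ge => _ [u _ <-]; rewrite le_searrow qcompA.
apply: le_trans (@rsP u); apply: qcomp_lel; rewrite -le_searrow.
by apply: qmeet_lb; exists u.
Qed.

Definition rs_sup (g : psh rs_cat) : rs_cat := RSOb (@rs_sup_right_sided g).

Lemma rs_adjoint (g : psh rs_cat) (v : rs_cat) :
  hcast erefl (erefl (psh_ty g)) (ht (rs_sup g) v) =
  psh_ht_fn g (yoneda_psh v).
Proof.
apply: le_anti; apply/andP; split.
- apply: qmeet_ge => _ [u _ <-]; rewrite le_searrow le_swarrow -qcompA.
  rewrite -le_searrow; have : rho (rs_sup g) v \oq rs_mor v <= rs_sup_mor g.
    by rewrite -le_swarrow.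
  by move=> /le_trans; apply; apply: qmeet_lb; exists u.
- rewrite /= le_swarrow; apply: qmeet_ge => _ [u _ <-].
  rewrite le_searrow qcompA -le_swarrow -le_searrow.
  by apply: qmeet_lb; exists u.
Qed.

Lemma rs_cocomplete : cocomplete rs_cat.
Proof. by exists (@adjoint_of Q rs_cat rs_sup (fun=> erefl) rs_adjoint); exact: rs_adjoint. Qed.

Definition rs_sc : sccat Q := SCCat rs_separated rs_cocomplete.

Lemma true_right_sided q : right_sided (tau q r).
Proof. exact: qtop_ge. Qed.

Program Definition true_functor : functor tau_sc rs_sc :=
  @Functor Q tau_sc rs_sc (fun q => RSOb (@true_right_sided q)) (fun=> erefl) _.
Next Obligation. by move=> p q; rewrite /= le_swarrow; apply: qtop_ge. Qed.

Lemma true_cocontinuous : cocontinuous true_functor.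
Proof.
move=> g; apply/esym.
have e : sup tau_sc g = psh_ty g :> Q := fn_ty (sup tau_sc) g.
rewrite e; apply: (@sup_eq Q rs_sc (psh_map true_functor g) (true_functor (psh_ty g)) erefl) => v.
rewrite -rs_adjoint.
suff h : tau (psh_ty g) r = rs_sup_mor (psh_map true_functor g).
  exact: (congr1 (fun w => swarrow w (rs_mor v)) h).
apply: le_anti; rewrite qtop_ge andbT; apply: qmeet_ge => _ [u _ <-].
rewrite le_searrow /= -le_swarrow; apply: qjoin_le => _ [q _ <-].
rewrite le_swarrow /= -qcompA -le_searrow.
apply: le_trans (qtop_ge _) _; rewrite le_searrow.
by rewrite -le_swarrow.
Qed.

Definition true_ : cocont tau_sc rs_sc := Cocont true_cocontinuous.

Variables (X : qcat Q) (phi : functor tau_cat X).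

Definition hom_into (x : X) : qhom r (ty x) :=
  hcast (fn_ty phi r) erefl (ht x (phi r)).

Lemma hom_into_right_sided x : right_sided (hom_into x).
Proof.
apply: le_trans (qcomp_ler _ (fn_ht phi r r)) _.
by rewrite hcast_comp hcast_le; apply: ht_comp.
Qed.

Definition hom_into_rs (x : X) : rs_ob := RSOb (hom_into_right_sided x).

End Objects.

(* Main.v *)
Require Import Defs.
From mathcomp Require Import all_boot all_order.
From mathcomp Require Import boolp classical_sets.

Set Implicit Arguments.
Unset Strict Implicit.

(** The square is a pullback because its points are forced.  Since the right
    edge is an identity, the claim reduces to one implication: every [x] in [X]
    for which [alpha(x, phi r)] is the top morphism of [hom(r, |x|)] is equal to
    [phi |x|].  Indeed, a cone [(f, g)] satisfies this hypothesis at each [f z],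
    whence [f = phi \o g], and [g] is the only possible mediating morphism.

    The implication ([hom_into_top_eq]) follows from separatedness and two
    inequalities, with [q := |x|].
    - [1_q <= alpha(phi q, x)]: the terminal object has [q] as supremum of the
      least presheaf of type [q], so the cocontinuous [phi] sends [q] to the
      supremum of a least presheaf of [X], from which every hom is the top one
      ([ht_cocont_tau]).
    - [1_q <= alpha(x, phi q)]: the composite
      [alpha(x, phi r) \oq alpha(phi r, phi q)] is a lower bound of
      [alpha(x, phi q)]; its first factor is top by hypothesis, the second one
      because [phi] is a functor, and stability at [r] says that the composite
      of these two top morphisms lies above the identity.

    It remains that [x |-> alpha(x, phi r)] is a morphism of the category, that
    is, cocontinuous ([hom_into_cocontinuous]).  Both sides of the equation to be
    proved are the meet over [x] of [searrow (g x) (alpha(x, phi r))]: the left one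
    by the adjunction defining suprema in [X], the right one by the formula for
    suprema of right-sided morphisms. *)

Import Order.TTheory.
Local Open Scope order_scope.
Local Open Scope classical_set_scope.

(* Kept folded, so that transports can be composed by rewriting. *)
Local Arguments hcast : simpl never.

Lemma le_hcast (Q : quantaloid) (p p' q : Q) (ep : p = p') (f : qhom p' q)
    (g : qhom p q) :
  (f <= hcast ep erefl g) = (hcast (esym ep) erefl f <= g).
Proof. by case: _ / ep f. Qed.

Lemma hcast_qtop (Q : quantaloid) (p p' q q' : Q) (ep : p = p') (eq : q = q') :
  hcast ep eq (qtop p q) = qtop p' q'.
Proof. by case: _ / ep; case: _ / eq. Qed.

Definition qbot (Q : quantaloid) (p q : Q) : qhom p q := qjoin set0.

Lemma qbot_le (Q : quantaloid) (p q : Q) (f : qhom p q) : qbot p q <= f.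
Proof. exact: qjoin_le. Qed.

Lemma qcomp_botl (Q : quantaloid) (p q r : Q) (f : qhom p q) :
  qbot q r \oq f = qbot p r.
Proof. by rewrite /qbot qcomp_joinl image_set0. Qed.

Lemma qcomp_botr (Q : quantaloid) (p q r : Q) (g : qhom q r) :
  g \oq qbot p q = qbot p r.
Proof. by rewrite /qbot qcomp_joinr image_set0. Qed.

Lemma rs_ob_eq (Q : quantaloid) (r : Q) (u v : rs_ob r)
    (e : rs_ty u = rs_ty v) :
  hcast erefl e (rs_mor u) = rs_mor v -> u = v.
Proof.
case: u v e => p u uP [q v vP] /= e; case: _ / e v vP => v vP /= uv.
by subst v; rewrite (Prop_irrelevance uP vP).
Qed.

Lemma sup_rs (Q : quantaloid) (r : Q) (g : psh (rs_cat r)) :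
  sup (rs_sc r) g = rs_sup g.
Proof. exact: (@sup_eq Q (rs_sc r) g (rs_sup g) erefl (rs_adjoint g)). Qed.

Lemma hom_into_ht (Q : quantaloid) (r : Q) (X : qcat Q)
    (phi : functor (tau_cat Q) X) (x1 x2 : X) :
  ht x1 x2 <= rho (hom_into_rs r phi x1) (hom_into_rs r phi x2).
Proof. by rewrite le_swarrow /= /hom_into hcast_compr hcast_le ht_comp. Qed.

Definition hom_into_functor (Q : quantaloid) (r : Q) (X : qcat Q)
    (phi : functor (tau_cat Q) X) : functor X (rs_cat r) :=
  @Functor Q X (rs_cat r) (hom_into_rs r phi) (fun=> erefl) (@hom_into_ht Q r X phi).

(** The supremum in right-sided morphisms is a meet over all right-sided [u],
    whereas the adjunction in [X] gives a meet over the points [x] only.  They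
    agree: the term at [u = alpha(x, phi r)] is below the one at [x] because
    [1 <= rho u u], and conversely the factor [rho u (alpha(x, phi r))] in the
    image presheaf carries [alpha(x, phi r)] below any given [u]. *)
Lemma hom_into_cocontinuous (Q : quantaloid) (r : Q) (X : sccat Q)
    (phi : functor (tau_cat Q) X) :
  cocontinuous (X := X) (Y := rs_sc r) (hom_into_functor r phi).
Proof.
move=> g; rewrite sup_rs; set h := psh_map _ g.
apply: (@rs_ob_eq Q r (hom_into_rs r phi (sup X g)) (rs_sup h)
  (fn_ty (sup X) g)) => /=.
rewrite /hom_into hcast_hcast.
(* The transports of domain and codomain commute, so the adjunction applies. *)
have -> : hcast (etrans (fn_ty phi r) erefl) (etrans erefl (fn_ty (sup X) g))
    (ht (sup X g) (phi r)) =
    hcast (fn_ty phi r) erefl (psh_ht_fn g (yoneda_psh (phi r))).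
  rewrite -[psh_ht_fn _ _](supP g (phi r)) hcast_hcast.
  congr (hcast _ _ _); exact: Prop_irrelevance.
apply: le_anti; apply/andP; split.
- apply: qmeet_ge => _ [u _ <-]; rewrite le_searrow -le_swarrow.
  apply: qjoin_le => _ [x _ <-]; rewrite le_swarrow /= -qcompA hcast_compr.
  apply: (@le_trans _ _ (rho u (hom_into_rs r phi x) \oq hom_into r phi x)).
    apply: qcomp_ler; rewrite hcast_le -le_searrow.
    by apply: qmeet_lb; exists x.
  by rewrite -le_swarrow.
- rewrite le_hcast; apply: qmeet_ge => _ [x _ <-].
  rewrite le_searrow hcast_compr -le_hcast -le_searrow; apply: le_trans (qmeet_lb _) _.
    by exists (hom_into_rs r phi x).
  rewrite le_searrow; apply: le_trans (qcomp_lel _ _) _; last first.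
    by rewrite -le_searrow.
  apply: le_trans (qjoin_ub _); last by exists x.
  rewrite -{1}[g x]qcomp1f; apply: qcomp_lel.
  exact: (ht_id (hom_into_rs r phi x : rs_cat r)).
Qed.

Lemma bot_psh_ht (Q : quantaloid) (X : qcat Q) (q : Q) (x1 x2 : X) :
  ht x1 x2 \oq qbot q (ty x2) <= qbot q (ty x1).
Proof. by rewrite qcomp_botr. Qed.

Definition bot_psh (Q : quantaloid) (X : qcat Q) (q : Q) : psh X :=
  Presheaf (@bot_psh_ht Q X q).

(** In the terminal object the supremum of a presheaf is its type, so [q] is the
    supremum of the least presheaf of type [q].  Its image under [phi] is a
    supremum over the empty diagram, hence initial. *)
Lemma ht_cocont_tau (Q : quantaloid) (X : sccat Q) (phi : cocont (tau_sc Q) X)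
    (q : Q) (x : X) :
  ht (phi q) x = qtop (ty x) (ty (phi q)).
Proof.
have supq : sup (tau_sc Q) (bot_psh (tau_cat Q) q) = q.
  exact: (fn_ty (sup (tau_sc Q)) (bot_psh (tau_cat Q) q)).
have -> : phi q = sup X (psh_map phi (bot_psh (tau_cat Q) q)).
  by rewrite -cocontP supq.
set g := psh_map _ _; apply: le_anti; rewrite qtop_ge /=.
rewrite -(hcast_le erefl (fn_ty (sup X) g)) (supP g x).
apply: qmeet_ge => _ [y _ <-]; rewrite le_searrow -le_swarrow.
apply: qjoin_le => _ [p _ <-].
by rewrite le_swarrow /= qcomp_botr qcomp_botl qbot_le.
Qed.

(** Stability enters here only, to produce the identity below a composite of two
    top morphisms through [r]. *)
Lemma hom_into_top_eq (Q : quantaloid) (r : Q) (X : sccat Q)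
    (phi : cocont (tau_sc Q) X) (x : X) :
  stable r -> hom_into r phi x = qtop r (ty x) -> phi (ty x) = x.
Proof.
move=> r_stable xtop.
apply: (separated_eq (e := fn_ty phi (ty x))) (@sccat_sep Q X) _ _.
  by rewrite ht_cocont_tau hcast_qtop qtop_ge.
apply: le_trans (r_stable (ty x)) _; rewrite -xtop.
apply: le_trans (qcomp_ler _ (fn_ht phi r (ty x))) _.
by rewrite hcast_comp hcast_le; apply: ht_comp.
Qed.

Theorem theorem4p9 (Q : quantaloid) (r : Q) (r_stable : stable r)
    (X : sccat Q) (phi : cocont (tau_sc Q) X) :
  exists chi : cocont X (rs_sc r),
    (forall x : X, chi x = hom_into_rs r phi x) /\
    is_pullback (C := Cat_sc Q) (A := tau_sc Q) (B := X)
      (A' := tau_sc Q) (B' := rs_sc r)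
      phi chi (cat_id (tau_sc Q : Cat_sc Q)) (true_ r).
Proof.
exists (Cocont (@hom_into_cocontinuous Q r X phi)); split=> //; split.
  apply: cocont_eq => q /=.
  apply: (@rs_ob_eq Q r (hom_into_rs r phi (phi q)) (true_ r q)
    (fn_ty phi q)) => /=.
  by rewrite /hom_into ht_cocont_tau !hcast_qtop.
move=> Z f g fg; exists g; split; last first.
  by move=> h [_ <-]; apply: cocont_eq.
split; last exact: cocont_eq.
apply: cocont_eq => z /=.
have -> : g z = ty (f z) by rewrite (fn_ty f z); exact: (fn_ty g z).
apply: hom_into_top_eq r_stable _.
have fgz : hom_into_rs r phi (f z) = true_ r (g z).
  exact: (congr1 (fun h : cocont Z (rs_sc r) => h z) fg).
(* The type of [f z] occurs in the type of the morphism, so both are rewritten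
   together as components of a point of the bottom right corner. *)
change (rs_mor (hom_into_rs r phi (f z)) =
  qtop r (rs_ty (hom_into_rs r phi (f z)))).
by rewrite fgz.
Qed.
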